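(* For every positive integer $r$ there is a constant $c=c(r)>0$ such that for every integer $n\ge 2$ there is a graph $G$ on $n$ vertices that is the union of $r$ comparability graphs, and neither $G$ nor its complement contains a biclique of size $\frac{cn}{(\log n)^r}$.
   Context: Graphs are finite and simple. A graph $G_0$ is a comparability graph if there is a partial order on its vertex set $V(G_0)$ such that two distinct vertices are adjacent in $G_0$ if and only if they are comparable in the partial order. $G$ is the union of $r$ comparability graphs $G_1,\dots,G_r$ if each $G_i$ has vertex set $V(G)$ and $E(G)=\bigcup_i E(G_i)$ (the edge sets need not be disjoint). A biclique is a complete bipartite graph with parts of equal size, and its size is the number of vertices in each part; a graph contains a biclique if it contains it as a (not necessarily induced) subgraph. For a real number $x>0$, ''contains a biclique of size $x$'' means containing a biclique whose parts have size $\lceil x\rceil$. $\log$ is the natural logarithm. *)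

(* Defs.v *)
From HB Require Import structures.
From mathcomp Require Import all_boot all_order all_algebra.
From mathcomp Require Import reals.

Set Implicit Arguments.
Unset Strict Implicit.
Unset Printing Implicit Defensive.

Import Order.TTheory GRing.Theory Num.Theory.

Record sgraph (T : finType) := SGraph {
  adj :> rel T;
  adj_sym : symmetric adj;
  adj_irr : irreflexive adj
}.

Section Complement.
Variables (T : finType) (G : sgraph T).

Definition compl_adj : rel T := [rel x y | (x != y) && ~~ G x y].

Lemma compl_adj_sym : symmetric compl_adj.
Proof. by move=> x y; rewrite /compl_adj /= eq_sym adj_sym. Qed.

Lemma compl_adj_irr : irreflexive compl_adj.
Proof. by move=> x; rewrite /compl_adj /= eqxx. Qed.

Definition compl_graph : sgraph T := SGraph compl_adj_sym compl_adj_irr.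

End Complement.

Definition partial_order (T : finType) (le : rel T) : Prop :=
  [/\ reflexive le, antisymmetric le & transitive le].

Definition comparability_graph (T : finType) (G : sgraph T) : Prop :=
  exists2 le : rel T, partial_order le &
    forall x y : T, x != y -> G x y = le x y || le y x.

Definition union_of_comparability (r : nat) (T : finType) (G : sgraph T) :
    Prop :=
  exists2 F : 'I_r -> sgraph T, (forall i, comparability_graph (F i)) &
    forall x y : T, G x y = [exists i, F i x y].

(* The biclique is a subgraph that need not be induced: nothing is required
   of pairs inside [A] or inside [B]. *)
Definition has_biclique (T : finType) (G : sgraph T) (k : nat) : Prop :=
  exists A B : {set T},
    [/\ #|A| = k, #|B| = k, [disjoint A & B] &
        forall x y : T, x \in A -> y \in B -> G x y].

(* Only meaningful for [0 < x], where the integer [Num.ceil x] is positive and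
   [absz] merely casts it to [nat]. *)
Definition has_biclique_real (R : realType) (T : finType) (G : sgraph T)
    (x : R) : Prop :=
  has_biclique G `|Num.ceil x|%N.

(* Main.v *)
Require Import Defs.
From mathcomp Require Import all_boot all_order all_fingroup all_algebra.
From mathcomp Require Import reals sequences exp.
From mathcomp Require Import zify ring lra.
Import Order.TTheory GRing.Theory Num.Theory.

(** The graph lives on a grid of antichains glued together by one expander.

    Let [E] be a symmetric relation of degree at most 38 on a set [T] of [8 q]
    points in which every set [X] has at least [4 |X|] or more than [4 q]
    neighbours.  The vertices are pairs [(x, u)] with [x] a cell of the grid
    [m ^ r] and [u] a point of [T].  For each coordinate [k], put
    [(x, u) <= (y, v)] in the [k]-th order when [t = y k - x k >= 0], no
    coordinate of [x] and [y] differs by more than [t], and there is an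
    [E]-walk of length [r * t] from [u] to [v].  Concatenating walks gives
    transitivity.  Any two distinct cells are at some sup-distance [t] attained
    at some coordinate [k], so vertices [(x, u)] and [(y, v)] are adjacent in
    the union [G] of the [r] comparability graphs as soon as [u] and [v] are
    joined by a walk of length [r * t].

    Sparsity: a vertex of [G] has at most [r * m ^ r * 38 ^ (r * m)]
    neighbours ([grid_graph_biclique]), which is of order [sqrt n] up to powers
    of [ln n] when [m] is a suitable small multiple of [ln n].

    Bicliques of the complement: by expansion, if no walk of length [n] joins
    [X] to [Y] then [|X| |Y| 4 ^ n <= |T| ^ 2] ([walk_free_mixing]).  Let [A]
    and [B] be completely non-adjacent in [G], with fibres [A_x] and [B_y] over
    the cells, and suppose that the largest fibre of all is [A_x].  Then
    [|B_y| ^ 2 <= |A_x| |B_y| <= |T| ^ 2 / 4 ^ (r t)], so that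
    [|B_y| <= |T| / 2 ^ (r t)], where [t] is the sup-distance of [x] and [y].
    As [r t] is at least the sum of the [|x l - y l|], summing over [y] splits
    into a product of [r] geometric series and yields [|B| <= 3 ^ r |T|]
    ([grid_graph_compl_biclique]).  Taking [|T|] of order [n / m ^ r] gives the
    bound.

    The expander comes from the union bound applied to 19 uniformly random
    permutations ([exists_expanding_perms]). *)

Set Implicit Arguments.
Unset Strict Implicit.
Unset Printing Implicit Defensive.

(** * Counting permutations that map one set into another *)

Section PermsInto.
Variable T : finType.
Implicit Types (X Y : {set T}) (s : {perm T}).

(** The permutations that map [X] into [Y]. *)
Definition perms_into X Y := [set s : {perm T} | [forall x in X, s x \in Y]].

Lemma perms_intoP X Y s :
  reflect (forall x, x \in X -> s x \in Y) (s \in perms_into X Y).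
Proof. by rewrite inE; apply: (iffP forall_inP). Qed.

(** Double counting of the pairs formed of a permutation sending [x |: X] into
    [Y] and a point [z] outside [X]: composing with the transposition of [x] and
    [z] turns them into the pairs where the permutation sends [X] and [z] into
    [Y]. *)
Lemma card_perms_intoU1 X Y x : x \notin X ->
  #|perms_into (x |: X) Y| * (#|T| - #|X|) =
  #|perms_into X Y| * (#|Y| - #|X|).
Proof.
move=> xX.
have moveE z : z \in ~: X ->
    #|perms_into (x |: X) Y| = \sum_(s in perms_into X Y) (s z \in Y).
  rewrite inE => zX.
  pose f s := (tperm x z * s)%g.
  have fK : involutive f by move=> s; rewrite /f mulgA tperm2 mul1g.
  rewrite -(on_card_preimset (f := f)); last first.
    by apply: onW_bij; exists f.
  rewrite -big_mkcondr /= sum1dep_card; apply: eq_card => s; rewrite [LHS]inE [RHS]in_set.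
  apply/perms_intoP/andP => [h|[/perms_intoP h sz] w].
    split; last by have := h x; rewrite /f permM tpermL !inE eqxx; apply.
    apply/perms_intoP => w wX; have := h w; rewrite /f permM tpermD.
    - by apply; rewrite !inE wX orbT.
    - by apply: contraNneq xX => ->.
    - by apply: contraNneq zX => ->.
  rewrite !inE => /predU1P[->|wX]; first by rewrite /f permM tpermL.
  rewrite /f permM tpermD ?h //.
  - by apply: contraNneq xX => ->.
  - by apply: contraNneq zX => ->.
have -> : #|T| - #|X| = #|~: X| by rewrite -(cardsC X) addKn.
rewrite mulnC -sum_nat_const (eq_bigr _ moveE) exchange_big /= -sum_nat_const.
apply: eq_bigr => s /perms_intoP sXY.
rewrite -big_mkcondr sum1dep_card.
have -> : #|Y| = #|s @^-1: Y|.
  by rewrite on_card_preimset //; apply/onW_bij/injF_bij/perm_inj.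
have XsY : X \subset s @^-1: Y by apply/subsetP => w wX; rewrite inE sXY.
rewrite -(setIidPr XsY) -cardsD (setIidPr XsY).
by apply: eq_card => z; rewrite !inE.
Qed.

(** A uniformly random permutation maps [X] into [Y] with probability at most
    [(|Y| / |T|) ^ |X|]. *)
Lemma leq_card_perms_into X Y :
  #|perms_into X Y| * #|T| ^ #|X| <= #|Y| ^ #|X| * #|T|`!.
Proof.
move: {2}#|X| (erefl #|X|) => k; elim: k X => [|k IH] X cX.
  rewrite cX !expn0 muln1 mul1n -cardsT -card_perm.
  by apply: subset_leq_card; apply/subsetP => s _; rewrite unfold_in; apply/subsetP.
have /card_gt0P[x xX] : 0 < #|X| by rewrite cX.
have cX' : #|X :\ x| = k by move: cX; rewrite (cardsD1 x) xX add1n => -[].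
have := card_perms_intoU1 Y (negbT (setD11 x X)).
rewrite setD1K // cX' cX => step.
have ltkN : k < #|T| by rewrite -cX; apply: max_card.
have {IH} := IH _ cX'; rewrite cX' => IH.
rewrite -(@leq_pmul2r (#|T| - k)) ?subn_gt0 //.
have YT : #|Y| <= #|T| by apply: max_card.
have : (#|Y| - k) * #|T| <= (#|T| - k) * #|Y|.
  by rewrite !mulnBl [#|Y| * _]mulnC leq_sub2l // leq_mul2l YT orbT.
move=> h; rewrite mulnAC step expnS [#|_| * (_ - _)]mulnC mulnACA.
apply: leq_trans (leq_mul h IH) _.
by rewrite expnS -!mulnA mulnC -!mulnA leq_mul2l; apply/orP; right; lia.
Qed.
End PermsInto.

(** * The union bound *)

Lemma leq_card_bigcup (I T : finType) (P : pred I) (F : I -> {set T}) :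
  #|\bigcup_(i | P i) F i| <= \sum_(i | P i) #|F i|.
Proof.
apply: (big_ind2 (fun (A : {set _}) n => #|A| <= n)) => // [|A a B b hA hB].
  by rewrite cards0.
by apply: leq_trans (leq_card_setU _ _) _; apply: leq_add.
Qed.

Lemma leq_expnn_fact k : k ^ k <= 4 ^ k * k`!.
Proof.
have ffact_ge n m : n ^ m <= (n + m) ^_ m.
  elim: m n => [|m IH] n; first by rewrite ffactn0.
  rewrite addnS ffactSS expnS leq_mul //; lia.
apply: leq_trans (ffact_ge k k) _; rewrite -bin_ffact leq_mul2r addnn.
apply/orP; right.
have -> : 4 ^ k = (1 + 1) ^ k.*2 by rewrite -muln2 mulnC expnM.
have lek : k < k.*2.+1 by lia.
by rewrite expnDn (bigD1 (Ordinal lek)) //= !exp1n !muln1 leq_addr.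
Qed.

Lemma leq_bin_expnn n k : 'C(n, k) * k ^ k <= (4 * n) ^ k.
Proof.
have ffact_le m : n ^_ m <= n ^ m.
  by elim: m => [|m IH]; rewrite ?ffactn0 // ffactnSr expnSr leq_mul ?leq_subr.
apply: leq_trans (leq_mul (leqnn _) (leq_expnn_fact k)) _.
by rewrite mulnCA bin_ffact expnMn leq_mul2l ffact_le orbT.
Qed.

(** The [s]-th root of this inequality is, after cancelling [(4 * s) ^ 4],
    [(4 * s) ^ 15 * 4 ^ 6 * N ^ 5 <= N ^ 19 * s], an equality for [N = 8 * s].
    The exponent 19 is chosen for this. *)
Lemma union_bound_ratio s N : 0 < s -> 8 * s <= N ->
  (4 * s) ^ (19 * s) * (4 * N) ^ (4 * s) * ((4 * N) ^ s * 4 ^ s)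
    <= N ^ (19 * s) * (4 * s) ^ (4 * s) * s ^ s.
Proof.
move=> s0 sN.
have base : (4 * s) ^ 15 * 4 ^ 6 * N ^ 5 <= N ^ 19 * s.
  (* With [u] in place of 2, so that no numeral gets evaluated. *)
  have gen u : u ^ 3 * s <= N ->
      (u ^ 2 * s) ^ 15 * (u ^ 2) ^ 6 * N ^ 5 <= N ^ 19 * s.
    move=> uN; apply: leq_trans (_ : (u ^ 3 * s) ^ 14 * (N ^ 5 * s) <= _).
      by apply/eq_leq; ring.
    by rewrite (expnD N 14 5) -mulnA leq_mul2r leq_exp2r // uN orbT.
  by have := gen 2; rewrite (_ : 2 ^ 2 = 4) // (_ : 2 ^ 3 = 8) //; apply.
rewrite !expnM -!expnMn leq_exp2r //.
rewrite [leqRHS]mulnAC (_ : (4 * s) ^ 19 = (4 * s) ^ 15 * (4 * s) ^ 4); last by rewrite -expnD.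
apply: leq_trans (leq_mul base (leqnn ((4 * s) ^ 4))); apply/eq_leq.
have comm u : (u * s) ^ 15 * (u * s) ^ 4 * (u * N) ^ 4 * (u * N * u) =
  (u * s) ^ 15 * u ^ 6 * N ^ 5 * (u * s) ^ 4 by ring.
exact: (comm 4).
Qed.

Lemma leq_mul_cancel_weights p w a m c1 x b1 c4 y b4 g :
  p * w <= a * m -> c4 * y <= b4 -> c1 * x <= b1 ->
  a * b4 * (b1 * g) <= w * y * x -> 0 < w * y * x ->
  p * c4 * (g * c1) <= m.
Proof.
move=> hp h4 h1 hw W0; rewrite -(leq_pmul2r W0).
apply: leq_trans (_ : m * (a * b4 * (b1 * g)) <= _); last first.
  by rewrite leq_mul2l hw orbT.
apply: leq_trans (_ : (p * w) * (c4 * y) * (c1 * x * g) <= _).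
  by apply/eq_leq; ring.
apply: leq_trans (leq_mul (leq_mul hp h4) (leq_mul h1 (leqnn _))) _.
by apply/eq_leq; ring.
Qed.

(** The number of 19-tuples of permutations all mapping [X] into [Y], multiplied
    by the number of choices for [Y] and then for [X], is at most
    [4 ^ (- |X|)] times the number of all 19-tuples. *)
Lemma card_perms_into_union_bound (T : finType) (X Y : {set T}) :
  0 < #|X| -> 8 * #|X| <= #|T| -> #|Y| = 4 * #|X| ->
  #|perms_into X Y| ^ 19 * 'C(#|T|, 4 * #|X|) * (4 ^ #|X| * 'C(#|T|, #|X|))
    <= #|T|`! ^ 19.
Proof.
move=> X0 XT cY.
have := leq_card_perms_into X Y; rewrite cY.
move: X0 XT; set s := #|X|; set N := #|T|; set P := #|perms_into X Y| => s0 sN hP.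
set M := N`! in hP *.
have hP19 : P ^ 19 * N ^ (19 * s) <= (4 * s) ^ (19 * s) * M ^ 19.
  by rewrite ![19 * s]mulnC !expnM -!expnMn leq_exp2r.
apply: (leq_mul_cancel_weights hP19 (leq_bin_expnn N (4 * s))
  (leq_bin_expnn N s) (union_bound_ratio s0 sN)).
by rewrite !muln_gt0 !expn_gt0; lia.
Qed.

Lemma sum_subsets_by_card (T : finType) (q : nat) (F : nat -> rat) :
  (\sum_(X : {set T} | (0 < #|X| <= q)%N) F #|X| =
   \sum_(1 <= s < q.+1) 'C(#|T|, s)%:R * F s)%R.
Proof.
rewrite big_add1 big_mkord /=.
rewrite (partition_big (fun X : {set T} => inord #|X|.-1 : 'I_q.-1.+1) predT) //=.
case: q => [|q].
  rewrite big_ord0 big1 // => i _; apply: big1 => X; lia.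
apply: eq_bigr => i _.
rewrite -card_draws mulr_natl -sumr_const.
apply: eq_big => [X|X /andP[hX /eqP <-]]; last by rewrite inordK; [congr F|]; lia.
rewrite inE; apply/andP/eqP => [[hX /eqP <-]|->].
  by rewrite inordK; lia.
split; first exact: ltn_ord.
by apply/eqP/val_inj; rewrite /= inordK.
Qed.

(** Some 19 permutations jointly send no small set [X] into a set four times as
    large: the tuples that fail for some [X] of size [s] form a fraction at most
    [4 ^ (- s)] of all tuples, and these fractions add up to less than 1. *)
Lemma exists_expanding_perms (T : finType) (q : nat) : #|T| = 8 * q ->
  exists f : {ffun 'I_19 -> {perm T}}, forall X Y : {set T},
    0 < #|X| <= q -> #|Y| = 4 * #|X| -> exists i, f i \notin perms_into X Y.
Proof.
move=> cT.
pose cond (X Y : {set T}) := (0 < #|X| <= q) && (#|Y| == (4 * #|X|)%N).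
pose bad (X Y : {set T}) := [set f : {ffun 'I_19 -> {perm T}} |
  f \in ffun_on (mem (perms_into X Y))].
pose Bad := \bigcup_(p | cond p.1 p.2) bad p.1 p.2.
have [/existsP[f fP]|] := boolP [exists f, f \notin Bad].
  exists f => X Y hX hY; apply/existsP; rewrite -[[exists _, _]]negbK negb_exists.
  apply: contra fP => /forallP h; apply/bigcupP; exists (X, Y) => /=.
    by rewrite /cond hX hY eqxx.
  by rewrite inE; apply/ffun_onP => i; have := h i; rewrite negbK.
rewrite negb_exists => /forallP allBad; exfalso.
pose M : rat := (#|T|`!%:R)%R.
have M0 : (0 < M)%R by rewrite ltr0n fact_gt0.
have cM : (#|{: {ffun 'I_19 -> {perm T}}}|%:R = M ^+ 19)%R.
  rewrite card_ffun card_ord -natrX; congr ((_ ^ _)%:R)%R.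
  rewrite -cardsT -[in RHS](cardsT T) -card_perm; apply: eq_card => s.
  rewrite [in RHS]unfold_in inE.
  by apply/esym/subsetP.
have : (M ^+ 19 <= \sum_(X : {set T} | (0 < #|X| <= q)%N)
                  \sum_(Y : {set T} | #|Y| == (4 * #|X|)%N) #|perms_into X Y|%:R ^+ 19)%R.
  rewrite -cM pair_big_dep /= -(eq_card (A := Bad)); last first.
    by move=> f; have := allBad f; rewrite negbK => ->; rewrite inE.
  apply: le_trans (_ : ((\sum_(p | cond p.1 p.2) #|bad p.1 p.2|)%:R <= _)%R).
    rewrite ler_nat.
    exact: leq_card_bigcup.
  rewrite natr_sum; apply: ler_sum => p _.
  by rewrite -natrX ler_nat /bad cardsE card_ffun_on card_ord.
apply/negP; rewrite -ltNge.
have inner (X : {set T}) : 0 < #|X| <= q ->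
    (\sum_(Y : {set T} | #|Y| == (4 * #|X|)%N) #|perms_into X Y|%:R ^+ 19
      <= M ^+ 19 / (4 ^ #|X| * 'C(#|T|, #|X|))%N%:R)%R.
  move=> /andP[X0 Xq].
  have c1 : (0 < 'C(#|T|, 4 * #|X|)) by rewrite bin_gt0; lia.
  apply: le_trans (_ : (\sum_(Y : {set T} | #|Y| == (4 * #|X|)%N)
     M ^+ 19 / (4 ^ #|X| * 'C(#|T|, #|X|))%N%:R / 'C(#|T|, (4 * #|X|)%N)%:R <= _)%R).
    apply: ler_sum => Y /eqP cY.
    have c2 : (0 < 'C(#|T|, #|X|)) by rewrite bin_gt0; lia.
    rewrite !ler_pdivlMr ?ltr0n // ?muln_gt0 ?c2 ?expn_gt0 //.
    rewrite -!natrX -!natrM ler_nat; apply: card_perms_into_union_bound => //; lia.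
  rewrite -[X in (X <= _)%R]big_set /= sumr_const card_draws -[leLHS]mulr_natr divfK //.
  by rewrite pnatr_eq0 -lt0n.
apply: le_lt_trans (ler_sum _ inner) _.
rewrite (sum_subsets_by_card _ _ (fun s => M ^+ 19 / (4 ^ s * 'C(#|T|, s))%N%:R)%R).
apply: le_lt_trans (_ : (\sum_(1 <= s < q.+1) M ^+ 19 * (1 / 4) ^+ s < _)%R).
  rewrite big_nat [leRHS]big_nat; apply: ler_sum => s hs.
  have c2 : ('C(#|T|, s)%:R != 0 :> rat)%R by rewrite pnatr_eq0 -lt0n bin_gt0; lia.
  rewrite natrM invfM mulrCA [(_ * (_^-1 * _))%R]mulrCA divff // mulr1.
  by rewrite natrX expr_div_n expr1n mul1r.
rewrite -mulr_sumr gtr_pMr ?exprn_gt0 //.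
have -> : (\sum_(1 <= s < q.+1) (1 / 4) ^+ s = (1 - (1 / 4) ^+ q) / 3 :> rat)%R.
  elim: (q) => [|k IH]; first by rewrite big_geq //; lra.
  by rewrite big_nat_recr //= IH exprS; lra.
have : (0 < (1 / 4) ^+ q :> rat)%R by rewrite exprn_gt0.
lra.
Qed.

(** * Neighbourhoods, walks and expansion *)

Lemma exists_subset_card (T : finType) (B : {set T}) k :
  k <= #|B| -> exists2 A : {set T}, A \subset B & #|A| = k.
Proof.
rewrite -bin_gt0 -cards_draws card_gt0 => /set0Pn[A].
by rewrite inE => /andP[AB /eqP cA]; exists A.
Qed.

Section Nbhd.
Variables (T : finType) (E : rel T).
Implicit Types X Y : {set T}.

(** The set of the successors of the points of [X]. *)
Definition nbhd X := [set v | [exists u in X, E u v]].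

Lemma nbhdP X v : reflect (exists2 u, u \in X & E u v) (v \in nbhd X).
Proof. by rewrite inE; apply: exists_inP. Qed.

Lemma nbhdS X Y : X \subset Y -> nbhd X \subset nbhd Y.
Proof.
move=> /subsetP XY; apply/subsetP => v /nbhdP[u uX Euv].
by apply/nbhdP; exists u => //; apply: XY.
Qed.

(** [walk n u v]: some sequence of exactly [n] [E]-steps leads from [u] to [v];
    vertices may be repeated. *)
Fixpoint walk n : rel T :=
  if n is n'.+1 then [rel u v | [exists w, E u w && walk n' w v]] else eq_op.

Lemma walkSP n u v :
  reflect (exists2 w, E u w & walk n w v) (walk n.+1 u v).
Proof. exact: exists_inP. Qed.

Lemma walk_cat m n u v w : walk m u v -> walk n v w -> walk (m + n) u w.
Proof.
elim: m u => [|m IH] u; first by move=> /eqP->.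
move=> /walkSP[x Eux xv] vw; rewrite addSn; apply/walkSP; exists x => //.
exact: IH.
Qed.

Lemma walk_sym : symmetric E -> forall n, symmetric (walk n).
Proof.
move=> symE n u v; suff h x y : walk n x y -> walk n y x by apply/idP/idP => /h.
elim: n x y => [|n IH] x y; first by rewrite /= eq_sym.
move=> /walkSP[w Exw /IH wy]; rewrite -addn1; apply: walk_cat wy _.
by apply/walkSP; exists x; rewrite /= ?eqxx // symE.
Qed.

Lemma card_walk_le d : (forall u, #|[set v | E u v]| <= d) ->
  forall n u, #|[set v | walk n u v]| <= d ^ n.
Proof.
move=> dE; elim=> [|n IH] u.
  rewrite expn0 -(cards1 u) subset_leq_card //.
  by apply/subsetP => v; rewrite !inE eq_sym.
apply: leq_trans (_ : \sum_(w in [set w | E u w]) #|[set v | walk n w v]| <= _).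
  apply: leq_trans (_ : #|\bigcup_(w in [set w | E u w]) [set v | walk n w v]| <= _).
    apply/subset_leq_card/subsetP => v; rewrite inE => /walkSP[w Euw wv].
    by apply/bigcupP; exists w; rewrite inE.
  exact: leq_card_bigcup.
apply: leq_trans (_ : \sum_(w in [set w | E u w]) d ^ n <= _).
  by apply: leq_sum => w _; apply: IH.
by rewrite sum_nat_const expnS leq_mul2r dE orbT.
Qed.
End Nbhd.

(** Permutations and their inverses together give a symmetric expander. *)
Lemma exists_expander (T : finType) (q : nat) : #|T| = 8 * q ->
  exists E : rel T, [/\ symmetric E, forall u, #|[set v | E u v]| <= 38 &
    forall X : {set T}, 4 * #|X| <= #|nbhd E X| \/ 4 * q < #|nbhd E X|].
Proof.
move=> cT; have [f fP] := exists_expanding_perms cT.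
pose E : rel T := [rel u v | [exists i, (v == f i u) || (u == f i v)]].
exists E; split.
- by move=> u v; apply: eq_existsb => i; rewrite orbC.
- move=> u; pose A := [set f i u | i in 'I_19].
  pose B := [set (f i)^-1%g u | i in 'I_19].
  apply: leq_trans (_ : #|A :|: B| <= _).
    apply/subset_leq_card/subsetP => v; rewrite inE => /existsP[i].
    case/orP => /eqP uv; apply/setUP; [left|right]; apply/imsetP; exists i => //.
    by rewrite uv permK.
  apply: leq_trans (leq_card_setU _ _) _.
  rewrite (_ : 38 = 19 + 19) // leq_add //.
    by apply: leq_trans (leq_imset_card _ _) _; rewrite card_ord.
  by apply: leq_trans (leq_imset_card _ _) _; rewrite card_ord.
have small (X : {set T}) : 0 < #|X| <= q -> 4 * #|X| < #|nbhd E X|.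
  move=> hX; rewrite ltnNge; apply/negP => hN.
  (* Enlarge the neighbourhood to a set [~: Z] of size exactly [4 * #|X|]. *)
  have : #|T| - 4 * #|X| <= #|~: nbhd E X|.
    by have := cardsC (nbhd E X); lia.
  move=> /exists_subset_card[Z ZN cZ].
  have cY : #|~: Z| = 4 * #|X| by have := cardsC Z; lia.
  have [i /negP[]] := fP X (~: Z) hX cY.
  apply/perms_intoP => x xX; rewrite inE; apply/negP => /(subsetP ZN).
  rewrite inE => /negP[]; apply/nbhdP; exists x => //.
  by apply/existsP; exists i; rewrite eqxx.
move=> X; have [Xq|qX] := leqP #|X| q.
  have [->|X0] := posnP #|X|; first by left.
  by left; apply/ltnW/small; rewrite X0.
have [X' X'X cX'] := exists_subset_card (ltnW qX).
right; rewrite -cX'; apply: leq_trans (subset_leq_card (nbhdS E X'X)).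
apply: small; rewrite cX' leqnn andbT.
by have : #|X| <= #|T| by [apply: max_card]; lia.
Qed.

Section ExpanderMixing.
Variables (T : finType) (E : rel T) (q : nat).
Hypothesis cT : #|T| = 8 * q.
Hypothesis symE : symmetric E.
Hypothesis expE :
  forall X : {set T}, 4 * #|X| <= #|nbhd E X| \/ 4 * q < #|nbhd E X|.
Implicit Types X Y : {set T}.

(** No walk of length [n] leads from [X] to [Y]. *)
Definition walk_free n X Y := forall u v, u \in X -> v \in Y -> ~~ walk E n u v.

Lemma walk_freeC n X Y : walk_free n X Y -> walk_free n Y X.
Proof. by move=> h u v uY vX; rewrite (walk_sym symE) h. Qed.

Lemma walk_free_nbhd n X Y : walk_free n.+1 X Y -> walk_free n (nbhd E X) Y.
Proof.
move=> h u v /nbhdP[w wX Ewu] vY; apply: contra (h w v wX vY) => uv.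
by apply/walkSP; exists u.
Qed.

(** Backward neighbourhoods of [Y] avoid more than half of the points, so they
    never exceed [4 * q] and keep growing by a factor 4. *)
Lemma walk_free_large n X Y :
  4 * q < #|X| -> walk_free n X Y -> #|Y| * 4 ^ n <= 4 * q.
Proof.
move=> Xq; elim: n Y => [|n IH] Y h.
  have : [disjoint X & Y].
    apply/pred0P => u /=; apply/negP => /andP[uX uY].
    by have := h u u uX uY; rewrite /= eqxx.
  rewrite -leq_card_setU => /eqP.
  have : #|X :|: Y| <= #|T| by apply: max_card.
  by rewrite expn0 muln1; lia.
have h' := walk_freeC (walk_free_nbhd (walk_freeC h)).
have := IH _ h'; rewrite expnS.
have [hY|hY] := expE Y.
  by move=> IHn; apply: leq_trans IHn; rewrite mulnA leq_mul2r mulnC hY orbT.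
have : 0 < 4 ^ n by rewrite expn_gt0.
by move: (4 ^ n) => z z0; nia.
Qed.

(** Either [X] grows by a factor 4 at the first step and induction applies to
    its neighbourhood, or [X] or its neighbourhood is large and all the decay
    falls on [Y]. *)
Lemma walk_free_mixing n X Y :
  walk_free n X Y -> #|X| * #|Y| * 4 ^ n <= (8 * q) ^ 2.
Proof.
elim: n X => [|n IH] X h.
  by rewrite muln1 leq_mul // -cT max_card.
have [Xq|Xq] := ltnP (4 * q) #|X|.
  have := walk_free_large Xq h; have : #|X| <= 8 * q by rewrite -cT max_card.
  rewrite -mulnA -mulnn => h1 h2; apply: leq_mul h1 _; lia.
have h' := walk_free_nbhd h.
have [hX|hX] := expE X.
  by apply: leq_trans (IH _ h'); rewrite expnS !mulnA leq_mul2r; nia.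
have := walk_free_large hX h'; rewrite expnS => h2.
apply: leq_trans (_ : 4 * #|X| * (#|Y| * 4 ^ n) <= _); first by apply/eq_leq; ring.
by apply: leq_trans (leq_mul (leq_mul (leqnn 4) Xq) h2) _; nia.
Qed.
End ExpanderMixing.

(** * Comparability graphs of orders and unions of graphs *)

Section OrderGraph.
Variables (T : finType) (le : rel T).

(** Comparability of distinct elements. *)
Definition order_adj : rel T := [rel x y | (x != y) && (le x y || le y x)].

Lemma order_adj_sym : symmetric order_adj.
Proof. by move=> x y; rewrite /order_adj /= eq_sym orbC. Qed.

Lemma order_adj_irr : irreflexive order_adj.
Proof. by move=> x; rewrite /order_adj /= eqxx. Qed.

Definition order_graph := SGraph order_adj_sym order_adj_irr.

Lemma order_graph_comparability :
  partial_order le -> comparability_graph order_graph.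
Proof. by move=> po; exists le => // x y xy; rewrite /= /order_adj /= xy. Qed.
End OrderGraph.

Section UnionGraph.
Variables (T : finType) (r : nat) (F : 'I_r -> sgraph T).

Definition union_adj : rel T := [rel x y | [exists i, F i x y]].

Lemma union_adj_sym : symmetric union_adj.
Proof. by move=> x y; apply: eq_existsb => i; rewrite adj_sym. Qed.

Lemma union_adj_irr : irreflexive union_adj.
Proof. by move=> x; apply/existsP => -[i]; rewrite adj_irr. Qed.

Definition union_graph := SGraph union_adj_sym union_adj_irr.
End UnionGraph.

(** * Distances of natural numbers *)

(** The distance of two natural numbers, one of the truncated differences being
    zero. *)
Definition absdiff a b := (a - b) + (b - a).

Lemma absdiffC a b : absdiff a b = absdiff b a.
Proof. by rewrite /absdiff addnC. Qed.

Lemma absdiff_le0 a b : absdiff a b <= 0 -> a = b.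
Proof. by rewrite /absdiff; lia. Qed.

Lemma absdiff_triangle a b c s t :
  absdiff a b <= s -> absdiff b c <= t -> absdiff a c <= s + t.
Proof. by rewrite /absdiff; lia. Qed.

Lemma absdiff_le_subn a b : a <= b -> absdiff a b = b - a.
Proof. by rewrite /absdiff; lia. Qed.

Lemma absdiff_lt m a b : a < m -> b < m -> absdiff a b <= m.
Proof. by rewrite /absdiff; lia. Qed.

Lemma absdiffnn a : absdiff a a = 0.
Proof. by rewrite /absdiff subnn. Qed.

Lemma sum_half_absdiff_le m a :
  (\sum_(j < m) (1 / 2) ^+ absdiff a j <= 3 :> rat)%R.
Proof.
pose S k : rat := (\sum_(j < k) (1 / 2) ^+ absdiff a j)%R.
have SS k : S k.+1 = (S k + (1 / 2) ^+ absdiff a k)%R by rewrite /S big_ord_recr.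
(* The terms before [a] double at each step; those after [a] halve. *)
have S_before k : k <= a -> (S k <= (1 / 2) ^+ (a - k)%N)%R.
  elim: k => [|k IH] ka; first by rewrite /S big_ord0 exprn_ge0.
  have := IH (ltnW ka); rewrite SS /absdiff (_ : k - a = 0); last by lia.
  by rewrite addn0 -[a - k]prednK ?subn_gt0 // -subnS exprS; lra.
have S_after k : (S (a + k)%N <= 3 - 2 * (1 / 2) ^+ k)%R.
  elim: k => [|k IH].
    by rewrite addn0; have := S_before a (leqnn a); rewrite subnn expr0; lra.
  rewrite addnS SS /absdiff (_ : a - (a + k) = 0) ?addKn; last by lia.
  by move: IH; rewrite exprS; lra.
have half_ge0 k : (0 <= (1 / 2) ^+ k :> rat)%R by rewrite exprn_ge0.
have [ma|am] := leqP m a.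
  have : ((1 / 2) ^+ (a - m)%N <= 1 :> rat)%R by rewrite exprn_ile1.
  by have := S_before m ma; rewrite /S; lra.
have := S_after (m - a); rewrite subnKC 1?ltnW // /S.
by have := half_ge0 (m - a); lra.
Qed.

(** * The graph on a grid of antichains *)

Section GridGraph.
Variables (r m : nat) (T : finType) (E : rel T).
Local Notation cell := {ffun 'I_r -> 'I_m}.
Local Notation vertex := (cell * T)%type.
Implicit Types (p s : vertex) (k l : 'I_r) (x y : cell).

(** [cone_le k p s]: the cell of [s] lies in the upward cone of the cell of [p]
    in the direction [k], at height [t], and a walk of length [r * t] joins their
    points.  The factor [r] pays for comparing the sup-distance of cells with the
    sum of the distances of their coordinates. *)
Definition cone_le k : rel vertex := [rel p s : vertex |
  [&& p.1 k <= s.1 k,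
      [forall l, absdiff (p.1 l) (s.1 l) <= s.1 k - p.1 k] &
      walk E (r * (s.1 k - p.1 k)) p.2 s.2]].

Lemma cone_le_order k : partial_order (cone_le k).
Proof.
split.
- move=> p; rewrite /cone_le /= subnn muln0 /= leqnn eqxx andbT.
  by apply/forallP => l; rewrite absdiffnn.
- move=> [x u] [y v]; rewrite /cone_le => /andP[/= /and3P[xy /forallP h w] /and3P[/= yx _ _]].
  have xyk : y k - x k = 0 by apply/eqP; rewrite subn_eq0.
  move: w; rewrite xyk muln0 => /eqP /= ->; congr pair.
  apply/ffunP => l; apply: val_inj; apply: absdiff_le0; rewrite -xyk; exact: h.
- move=> [y v] [x u] [z w]; rewrite /cone_le /= => /and3P[xy /forallP hxy wxy].
  move=> /and3P[yz /forallP hyz wyz].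
  have e : z k - x k = (y k - x k) + (z k - y k).
    by rewrite addnC addnBA // subnK.
  rewrite (leq_trans xy yz) e mulnDr (walk_cat wxy wyz) andbT /=.
  by apply/forallP => l; apply: absdiff_triangle (hxy l) (hyz l).
Qed.

(** In a direction [k] realising the sup-distance, one of two distinct cells lies
    in the cone of the other. *)
Lemma cone_le_cover (x y : cell) : x != y -> exists k,
  [/\ 0 < absdiff (x k) (y k),
      forall l, absdiff (x l) (y l) <= absdiff (x k) (y k) &
      symmetric E -> forall u v, walk E (r * absdiff (x k) (y k)) u v ->
        cone_le k (x, u) (y, v) || cone_le k (y, v) (x, u)].
Proof.
move=> xy.
have [l0 hl0] : exists l0, x l0 != y l0.
  apply/existsP; rewrite -negb_forall; apply: contra xy => /forallP h.
  by apply/eqP/ffunP => l; apply/eqP.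
have [k _ hk] := arg_maxnP (fun l => absdiff (x l) (y l)) (erefl (predT l0)).
exists k; split; last move=> symE u v w; rewrite /cone_le /=.
- apply: leq_trans (hk l0 isT); rewrite lt0n; apply: contra hl0 => /eqP e0.
  by apply/eqP; apply: val_inj; apply: absdiff_le0; rewrite e0.
- by move=> l; apply: hk.
- have [xyk|yxk] := leqP (x k) (y k); apply/orP; [left|right].
    rewrite -absdiff_le_subn // w andbT /=.
    by apply/forallP => l; apply: hk.
  rewrite (ltnW yxk) -absdiff_le_subn 1?ltnW // absdiffC walk_sym // w andbT /=.
  by apply/forallP => l; rewrite absdiffC; apply: hk.
Qed.

Variables (U : finType) (h : U -> vertex).
Hypothesis h_inj : injective h.

Definition grid_order_graph k := order_graph [rel a b | cone_le k (h a) (h b)].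

(** The vertices are drawn from the grid through an injection [h]. *)
Definition grid_graph := union_graph grid_order_graph.

Lemma grid_graph_union : union_of_comparability r grid_graph.
Proof.
exists grid_order_graph => // k; apply: order_graph_comparability.
have [rfl asym trn] := cone_le_order k; split.
- by move=> a; apply: rfl.
- by move=> a b /asym /h_inj.
- by move=> b a c; apply: trn.
Qed.

(** One side of a biclique lies in the neighbourhood of any vertex of the other
    side, and degrees are small. *)
Lemma grid_graph_biclique d n : symmetric E -> 0 < d ->
  (forall u, #|[set v | E u v]| <= d) -> 0 < n ->
  has_biclique grid_graph n -> n <= r * (m ^ r * d ^ (r * m)).
Proof.
move=> symE d0 dE n0 [A [B [cA cB _ AB]]].
have /card_gt0P[a aA] : 0 < #|A| by rewrite cA.
pose p := h a.
pose F k y := [set (y, v) | v in [set v | walk E (r * absdiff (p.1 k) (y k)) p.2 v]].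
have hB : h @: B \subset \bigcup_(k in 'I_r) \bigcup_(y in {: cell}) F k y.
  apply/subsetP => _ /imsetP[b bB ->].
  have /existsP[k /andP[_ hk]] := AB _ _ aA bB.
  apply/bigcupP; exists k => //; apply/bigcupP; exists (h b).1 => //.
  apply/imsetP; exists (h b).2; last by case: (h b).
  rewrite inE; case/orP: hk => /and3P[ab _].
    by rewrite absdiff_le_subn.
  by rewrite walk_sym // absdiffC absdiff_le_subn.
rewrite -cB -(card_imset _ h_inj).
apply: leq_trans (subset_leq_card hB) _.
apply: leq_trans (leq_card_bigcup _ _) _.
rewrite -[X in X * _](card_ord r) -sum_nat_const; apply: leq_sum => k _.
apply: leq_trans (leq_card_bigcup _ _) _.
have <- : #|{: cell}| = m ^ r by rewrite card_ffun !card_ord.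
rewrite -sum_nat_const; apply: leq_sum => y _.
apply: leq_trans (leq_imset_card _ _) _.
apply: leq_trans (card_walk_le dE _ _) _.
rewrite leq_pexp2l // leq_mul2l; apply/orP; right.
by apply: absdiff_lt; apply: ltn_ord.
Qed.

(** The points of [T] that [A] occupies over the cell [x]. *)
Definition fiber (A : {set U}) x := [set u | (x, u) \in h @: A].

Lemma card_fibers (A : {set U}) : #|A| = \sum_x #|fiber A x|.
Proof.
rewrite -(card_imset _ h_inj) -sum1_card (partition_big fst predT) //=.
apply: eq_bigr => x _; rewrite sum1dep_card.
have inj_x : injective (pair x : T -> vertex) by move=> u v [].
rewrite -(card_imset _ inj_x); apply: eq_card => -[y u].
rewrite [LHS]inE /=; apply/andP/imsetP => [[yu /eqP<-]|[v vA [-> ->]]].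
  by exists u; rewrite ?inE.
by move: vA; rewrite inE => ->.
Qed.

Variable q : nat.
Hypothesis cT : #|T| = 8 * q.
Hypothesis symE : symmetric E.
Hypothesis expE :
  forall X : {set T}, 4 * #|X| <= #|nbhd E X| \/ 4 * q < #|nbhd E X|.

Lemma grid_graph_fibers (A B : {set U}) x y :
  (forall a b, a \in A -> b \in B -> ~~ grid_graph a b) ->
  #|fiber A x| * #|fiber B y| * (\prod_l 2 ^ absdiff (x l) (y l)) ^ 2
    <= (8 * q) ^ 2.
Proof.
move=> AB; have [->|xy] := eqVneq x y.
  rewrite big1 => [|l _]; last by rewrite absdiffnn.
  by rewrite muln1 -cT leq_mul ?max_card.
have [k [k0 hk hE]] := cone_le_cover xy.
have wf : walk_free E (r * absdiff (x k) (y k)) (fiber A x) (fiber B y).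
  move=> u v; rewrite !inE => /imsetP[a aA ea] /imsetP[b bB eb].
  apply/negP => /(hE symE); rewrite ea eb => hab.
  have /negP[] := AB a b aA bB; apply/existsP; exists k.
  rewrite /= /order_adj /= hab andbT; apply: contraTneq k0 => ab.
  by move: eb; rewrite -ab -ea => -[->]; rewrite absdiffnn.
apply: leq_trans (walk_free_mixing cT symE expE wf).
rewrite leq_mul2l; apply/orP; right.
have -> n : 4 ^ n = (2 ^ n) ^ 2 by rewrite -expnM mulnC expnM.
rewrite leq_exp2r //.
apply: leq_trans (_ : \prod_(l < r) 2 ^ absdiff (x k) (y k) <= _).
  by apply: leq_prod => l _; rewrite leq_pexp2l.
by rewrite prod_nat_const card_ord -expnM mulnC.
Qed.

(** The sum over the cells [y] factors into [r] two-sided geometric series. *)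
Lemma card_le_of_fibers (A : {set U}) x :
  (forall y, #|fiber A y| * \prod_l 2 ^ absdiff (x l) (y l) <= 8 * q) ->
  #|A| <= 3 ^ r * (8 * q).
Proof.
move=> hA; rewrite -(ler_nat rat) card_fibers natr_sum.
have hA' y : (#|fiber A y|%:R <= (8 * q)%:R * \prod_l (1 / 2) ^+ absdiff (x l) (y l) :> rat)%R.
  have := hA y; rewrite -(ler_nat rat) natrM natr_prod.
  set P := (\prod_l (_)%:R)%R; have P0 : (0 < P)%R.
    by apply: prodr_gt0 => l _; rewrite ltr0n expn_gt0.
  rewrite -ler_pdivlMr //; congr (_ <= _ * _)%R.
  rewrite /P -prodfV; apply: eq_bigr => l _.
  by rewrite natrX expr_div_n expr1n div1r.
apply: le_trans (ler_sum _ (fun y _ => hA' y)) _.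
rewrite -mulr_sumr [in leRHS]mulnC [leRHS]natrM; apply: ler_wpM2l => //.
rewrite -(bigA_distr_bigA (fun l (j : 'I_m) => (1 / 2) ^+ absdiff (x l) j : rat)%R).
rewrite natrX -[X in (_ <= _ ^+ X)%R](card_ord r) -prodr_const.
apply: ler_prod => l _; rewrite sum_half_absdiff_le andbT.
by apply: sumr_ge0 => j _; rewrite exprn_ge0.
Qed.

Lemma grid_graph_compl_biclique n :
  has_biclique (compl_graph grid_graph) n -> n <= 3 ^ r * (8 * q).
Proof.
move=> [A [B [cA cB _ AB]]].
have {}AB a b : a \in A -> b \in B -> ~~ grid_graph a b.
  by move=> aA bB; have /andP[] := AB a b aA bB.
have [->//|n0] := posnP n.
have /card_gt0P[a _] : 0 < #|A| by rewrite cA.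
(* The case where some fibre of [C] dominates all the fibres of [D]. *)
have hmax (C D : {set U}) x :
    (forall a b, a \in C -> b \in D -> ~~ grid_graph a b) ->
    (forall y, #|fiber D y| <= #|fiber C x|) -> #|D| <= 3 ^ r * (8 * q).
  move=> CD hx; apply: (@card_le_of_fibers _ x) => y.
  rewrite -leq_sqr expnMn; apply: leq_trans (grid_graph_fibers x y CD).
  by rewrite leq_mul2r -mulnn leq_mul2r hx !orbT.
pose fmax C := [arg max_(x > (h a).1) #|fiber C x|].
have fmaxP C y : #|fiber C y| <= #|fiber C (fmax C)|.
  by rewrite /fmax; case: arg_maxnP => // x _; apply.
have [BA|AB'] := leqP #|fiber B (fmax B)| #|fiber A (fmax A)|.
  rewrite -cB; apply: (hmax A B (fmax A)) => // y.
  exact: leq_trans (fmaxP B y) BA.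
rewrite -cA; apply: (hmax B A (fmax B)) => [b c bB cA'|y].
  by rewrite adj_sym AB.
exact: leq_trans (fmaxP A y) (ltnW AB').
Qed.
End GridGraph.

(** * Choice of the parameters *)

Local Open Scope ring_scope.

Lemma exprn_le_fact_expR (R : realType) (x : R) k :
  0 <= x -> x ^+ k <= k`!%:R * expR x.
Proof.
move=> x0; case: k => [|k].
  by rewrite expr0 mul1r; have := expR_ge1Dx x; lra.
rewrite mulrC -ler_pdivrMr ?ltr0n ?fact_gt0 //.
by have := expR_ge1Dxn k x0; lra.
Qed.

(** With [L = ln n], the grid has side [m], about [L / (76 * r)], so that
    [38 ^ (r * m) <= expR (38 * r * m)] is of order [expR (L / 2)], the square
    root of [n].  Powers of [L] are absorbed by the other half of
    [n = expR (L / 2) * expR (L / 2)]. *)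
Lemma exists_grid_parameters (R : realType) (r : nat) : (0 < r)%N ->
  exists c : R, 0 < c /\ forall n : nat, (2 <= n)%N -> exists m q : nat,
    [/\ (n <= m ^ r * (8 * q))%N,
        (r * (m ^ r * 38 ^ (r * m)))%:R < c * n%:R / ln n%:R ^+ r &
        (3 ^ r * (8 * q))%:R < c * n%:R / ln n%:R ^+ r].
Proof.
move=> r0; pose a : R := 76 * r%:R.
have r1 : 1 <= r%:R :> R by rewrite ler1n.
have a1 : 1 <= a by rewrite /a; lra.
pose C : R := 2 ^+ (2 * r) * ((2 * r)`!%:R * expR (1 / 2)).
pose c1 : R := r%:R * expR (38 * r%:R) * C.
pose c2 : R := (3 ^ r * 8)%:R * (a ^+ r + C).
have C0 : 0 < C.
  by rewrite !mulr_gt0 ?exprn_gt0 ?expR_gt0 ?ltr0n ?fact_gt0.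
have c10 : 0 < c1.
  by apply: mulr_gt0 => //; apply: mulr_gt0; rewrite ?expR_gt0 ?ltr0n.
have c20 : 0 < c2.
  rewrite mulr_gt0 ?ltr0n ?muln_gt0 ?expn_gt0 // addr_gt0 // exprn_gt0 //; lra.
exists (c1 + c2); split=> [|n n2]; first exact: addr_gt0.
have n0 : 0 < n%:R :> R by rewrite ltr0n; lia.
set L := ln n%:R.
have L0 : 0 < L by apply: ln_gt0; rewrite ltr1n.
have eL : expR L = n%:R by apply: lnK.
have powL : (L + 1) ^+ (2 * r) <= C * expR (L / 2).
  have h0 : 0 <= (L + 1) / 2 by lra.
  have := exprn_le_fact_expR (2 * r) h0.
  have -> : (L + 1) / 2 = 1 / 2 + L / 2 by lra.
  rewrite expRD => h.
  have -> : L + 1 = 2 * (1 / 2 + L / 2) by lra.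
  rewrite exprMn /C -!mulrA ler_pM2l ?exprn_gt0 //.
have hLr : L ^+ r <= (L + 1) ^+ r by apply: lerXn2r; rewrite ?nnegrE; lra.
have one_le : 1 <= (L + 1) ^+ r by apply: exprn_ege1; lra.
have halfL : expR (L / 2) * expR (L / 2) = n%:R.
  by rewrite -expRD -eL; congr expR; lra.
have half1 : 1 <= expR (L / 2) by rewrite -[leLHS]expR0 ler_expR; lra.
have Lr0 : 0 < L ^+ r by apply: exprn_gt0.
pose m := (Num.truncn (L / a)).+1; pose q := (n %/ m ^ r).+1.
have m_gt : L / a < m%:R by apply: truncnS_gt.
have m_le : m%:R <= L / a + 1.
  by rewrite /m -natr1 lerD2r truncn_le divr_ge0 //; lra.
have La : L / a <= L by rewrite ler_pdivrMr ?ler_peMr ?(ltW L0) //; lra.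
have mr0 : (0 < m ^ r)%N by rewrite expn_gt0.
exists m, q; split.
- rewrite mulnCA; apply: leq_trans (ltnW (ltn_ceil n mr0)) _.
  by rewrite mulnC leq_pmull.
- rewrite ltr_pdivlMr //; apply: le_lt_trans (_ : c1 * n%:R < _); last first.
    by rewrite ltr_pM2r //; lra.
  have e38 : (38 ^ (r * m))%:R <= expR (38 * r%:R) * expR (L / 2).
    apply: le_trans (_ : expR (38 * (r * m)%:R) <= _).
      rewrite natrX expRM_natr lerXn2r ?nnegrE ?expR_ge0 //.
      by have := expR_ge1Dx (38 : R); lra.
    rewrite -expRD ler_expR natrM.
    have : r%:R * m%:R <= r%:R * (L / a + 1) by rewrite ler_pM2l //; lra.
    have -> : r%:R * (L / a + 1) = L / 76 + r%:R by rewrite /a; field; lra.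
    lra.
  have hm : (m ^ r)%:R <= (L + 1) ^+ r.
    have mL : m%:R <= L + 1 by rewrite (le_trans m_le) // lerD2r.
    by rewrite natrX lerXn2r ?nnegrE ?ler0n ?(le_trans (ler0n R m) mL).
  have hmL : (m ^ r)%:R * L ^+ r <= C * expR (L / 2).
    apply: le_trans powL; rewrite mul2n -addnn exprD.
    by apply: ler_pM; rewrite ?ler0n // ltW.
  have -> : c1 * n%:R = r%:R * ((C * expR (L / 2)) * (expR (38 * r%:R) * expR (L / 2))).
    by rewrite -halfL /c1; ring.
  rewrite natrM -[leLHS]mulrA ler_pM2l ?ltr0n //.
  rewrite natrM mulrAC; apply: ler_pM => //.
  by rewrite mulr_ge0 // ltW.
- rewrite ltr_pdivlMr //; apply: le_lt_trans (_ : c2 * n%:R < _); last first.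
    by rewrite ltr_pM2r //; lra.
  rewrite mulnA natrM /c2 -!mulrA ler_pM2l ?ltr0n ?muln_gt0 ?expn_gt0 //.
  rewrite /q -natr1 mulrDl mulrDl mul1r; apply: lerD.
    apply: le_trans (_ : n%:R / (m ^ r)%:R * L ^+ r <= _).
      rewrite ler_pM2r // ler_pdivlMr ?ltr0n // -natrM ler_nat.
      exact: leq_trunc_div.
    have -> : n%:R / (m ^ r)%:R * L ^+ r = L ^+ r / (m ^ r)%:R * n%:R by ring.
    rewrite ler_pM2r // ler_pdivrMr ?ltr0n // natrX -exprMn.
    have a0 : 0 < a by lra.
    have LaM : L <= a * m%:R by rewrite mulrC -ler_pdivrMr // ltW.
    by apply: lerXn2r => //; rewrite nnegrE; lra.
  apply: le_trans (_ : (L + 1) ^+ (2 * r) <= _).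
    rewrite mul2n -addnn exprD; nra.
  apply: le_trans powL _; rewrite ler_pM2l // -halfL; nra.
Qed.

Theorem theorem3 (R : realType) (r : nat) (hr : (0 < r)%N) :
  exists c : R, 0 < c /\
    forall n : nat, (2 <= n)%N ->
      exists G : sgraph 'I_n,
        [/\ union_of_comparability r G,
            ~ has_biclique_real G (c * n%:R / ln n%:R ^+ r) &
            ~ has_biclique_real (compl_graph G) (c * n%:R / ln n%:R ^+ r)].
Proof.
have [c [c0 hc]] := exists_grid_parameters R hr.
exists c; split=> // n n2; have [m [q [nV kG kGc]]] := hc n n2.
move: kG kGc; set x := _ / _ => kG kGc.
(* [x] is positive, hence so is its ceiling and [absz] leaves it unchanged. *)
have x_le : x <= `|Num.ceil x|%N%:R.
  rewrite natr_absz ger0_norm ?ceil_ge //.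
  by rewrite ceil_ge0; apply: lt_le_trans (ltW kG); rewrite (lt_le_trans (ltrN10 _)).
have [E [symE degE expE]] := exists_expander (card_ord (8 * q)).
have cV : (n <= #|{: {ffun 'I_r -> 'I_m} * 'I_(8 * q)}|)%N.
  by rewrite card_prod card_ffun !card_ord.
pose h (i : 'I_n) := enum_val (widen_ord cV i).
have h_inj : injective h.
  by move=> i j /enum_val_inj /(congr1 val) /= /val_inj.
exists (grid_graph E h); split; first exact: grid_graph_union.
- have k0 : (0 < `|Num.ceil x|)%N.
    by rewrite -(ltr_nat R); apply: lt_le_trans x_le; apply: le_lt_trans kG.
  move=> /(grid_graph_biclique h_inj symE (isT : 0 < 38)%N degE k0).
  by rewrite leqNgt -(ltr_nat R) (lt_le_trans kG x_le).
- move=> /(grid_graph_compl_biclique h_inj (card_ord _) symE expE).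
  by rewrite leqNgt -(ltr_nat R) (lt_le_trans kGc x_le).
Qed.
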